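(* For every bounded domain $\Omega\subset\mathbb{C}^2$, there exist infinitely many real-analytic plurisubharmonic solutions $u$ to $\det(\partial\bar\partial u)=1$ on $\Omega$ such that the induced Kähler metric $\partial\bar\partial u$ is nowhere flat on $\Omega$.
   Context: Coordinates on $\mathbb{C}^2$ are $(z,w)$. For a real-valued function $u$ on an open subset of $\mathbb{C}^2$, $\partial\bar\partial u$ denotes its complex Hessian, the $2\times 2$ matrix $\begin{bmatrix} u_{\bar z z} & u_{z\bar w}\\ u_{\bar z w} & u_{\bar w w}\end{bmatrix}$. A plurisubharmonic solution of $\det(\partial\bar\partial u)=1$ has positive definite complex Hessian, so $g_{\alpha\bar\beta}=(\partial\bar\partial u)_{\alpha\bar\beta}$ defines a Kähler metric. The metric is nowhere flat if its curvature tensor is nonzero at every point. *)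

(* Defs.v *)
From HB Require Import structures.
From mathcomp Require Export all_boot all_order all_algebra.
From mathcomp Require Export complex.
From mathcomp Require Export all_classical all_reals all_analysis.
Export Order.TTheory GRing.Theory Num.Theory numFieldNormedType.Exports.

Set Implicit Arguments.
Unset Strict Implicit.
Unset Printing Implicit Defensive.

#[global] Open Scope classical_set_scope.
#[global] Open Scope complex_scope.
#[global] Open Scope ring_scope.

(* C^2 as row vectors: z = p 0 0 and w = p 0 1. The alias R[i]^o is what carries
   the topology and norm of the field R[i] in MathComp-Analysis. *)
Notation C2 R := 'rV[R[i]^o]_2.

Definition is_domain (R : realType) (D : set (C2 R)) : Prop :=
  [/\ D !=set0, open D & connected D].

(* The derivative at p of a complex-valued f along v, with a real parameter; it
   is taken on Re f and Im f since R[i] is not a normed module over R. As derive1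
   is total, this is meaningful only where the derivative exists, which is the
   case at every use below for u real-analytic. *)
Definition real_derive (R : realType) (v : C2 R) (f : C2 R -> R[i]) (p : C2 R) :
    R[i] :=
  derive1 (fun t : R => complex.Re (f (p + t%:C *: v))) 0 +i*
  derive1 (fun t : R => complex.Im (f (p + t%:C *: v))) 0.

(* Wirtinger derivatives (d/dx - i d/dy) / 2 and (d/dx + i d/dy) / 2. *)
Definition dz (R : realType) (j : 'I_2) (f : C2 R -> R[i]) (p : C2 R) : R[i] :=
  (real_derive (delta_mx 0 j) f p
   - 'i%C * real_derive ('i%C *: delta_mx 0 j) f p) / 2.

Definition dzbar (R : realType) (j : 'I_2) (f : C2 R -> R[i]) (p : C2 R) : R[i] :=
  (real_derive (delta_mx 0 j) f p
   + 'i%C * real_derive ('i%C *: delta_mx 0 j) f p) / 2.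

Definition complex_hessian (R : realType) (u : C2 R -> R) (p : C2 R) : 'M[R[i]]_2 :=
  \matrix_(a, b) dz a (dzbar b (fun q => (u q)%:C)) p.

(* The component R_{a bbar c dbar} of the curvature tensor of the Kaehler metric
   g_{a bbar} = complex_hessian u:
     - d_c d_dbar g_{a bbar}
     + sum_(k, l) g^{k lbar} (d_c g_{a lbar}) (d_dbar g_{k bbar}),
   where g^{k lbar} is the entry (l, k) of the inverse matrix. *)
Definition curvature (R : realType) (u : C2 R -> R) (p : C2 R)
    (a b c d : 'I_2) : R[i] :=
  let g (j k : 'I_2) (q : C2 R) : R[i] := complex_hessian u q j k in
  - dz c (dzbar d (g a b)) p
  + \sum_(k < 2) \sum_(l < 2)
      invmx (complex_hessian u p) l k * dz c (g a l) p * dzbar d (g k b) p.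

Definition nowhere_flat (R : realType) (D : set (C2 R)) (u : C2 R -> R) : Prop :=
  forall p, D p -> exists a b c d : 'I_2, curvature u p a b c d != 0.

Definition usc_on (R : realType) (T : topologicalType) (D : set T) (f : T -> R) :
    Prop :=
  forall x, D x -> forall c : R, f x < c -> \forall y \near x, f y < c.

(* For D open: upper semicontinuity and the sub-mean value inequality on the
   boundary of every closed disc contained in D. For f real-valued and
   upper semicontinuous the extended integral is well defined in [-oo, +oo[. *)
Definition subharmonic (R : realType) (D : set R[i]^o) (f : R[i]^o -> R) : Prop :=
  usc_on D f /\
  forall (c : R[i]^o) (r : R), 0 < r ->
    (forall x : R[i]^o, `|x - c| <= r%:C -> D x) ->
    ((2 * pi * f c)%R%:E <=
     \int[lebesgue_measure]_(t in `[0%R, (2 * pi)%R])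
        (f (c + r%:C * (cos t +i* sin t))%R)%:E)%E.

Definition plurisubharmonic (R : realType) (D : set (C2 R)) (u : C2 R -> R) : Prop :=
  usc_on D u /\
  forall a b : C2 R,
    subharmonic [set x : R[i]^o | D (a + x *: b)] (fun x => u (a + x *: b)).

Definition monomial (R : realType) (n : nat) (m : {ffun 'I_n -> nat})
    (h : 'rV[R]_n) : R :=
  \prod_(i < n) h 0 i ^+ m i.

(* f is the sum of an absolutely convergent multiple power series on a polydisc
   around x. The sum over all multi-indices is taken along the cubes
   [0, N - 1]^n, which is immaterial under absolute convergence. *)
Definition real_analytic_at (R : realType) (n : nat) (f : 'rV[R]_n -> R)
    (x : 'rV[R]_n) : Prop :=
  exists (a : {ffun 'I_n -> nat} -> R) (r : R), 0 < r /\
    forall h : 'rV[R]_n, (forall i, `|h 0 i| < r) ->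
      let term (m : {ffun 'I_n -> nat}) : R := a m * monomial m h in
      summable [set: {ffun 'I_n -> nat}] (fun m => (term m)%:E) /\
      (fun N : nat => \sum_(m : {ffun 'I_n -> 'I_N})
         term [ffun i => m i : nat]) @ \oo --> f (x + h).

(* R^4 -> C^2, where R^4 has the coordinates (Re z, Re w, Im z, Im w). *)
Definition C2_of_R4 (R : realType) (x : 'rV[R]_(2 + 2)) : C2 R :=
  \row_(j < 2) (x 0 (lshift 2 j) +i* x 0 (rshift 2 j)).

Definition real_analytic_on (R : realType) (D : set (C2 R)) (u : C2 R -> R) : Prop :=
  forall x : 'rV[R]_(2 + 2), D (C2_of_R4 x) ->
    real_analytic_at (fun y => u (C2_of_R4 y)) x.

(* Main.v *)
Require Import Defs.
From mathcomp Require Import finmap ring lra.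

(** For x > 0 the function pot (x, t) = 4/3 x^3 + t^2 / x solves the real
    Monge-Ampere equation pot_xx pot_tt - pot_xt^2 = 16 and is convex. When a
    real function depends only on the real parts x = Re z + c and t = Re w, each
    Wirtinger derivative is half of the corresponding real one, so the complex
    Hessian of sol c (z, w) = pot (Re z + c, Re w) is a quarter of the real
    Hessian and has determinant 1. A bounded Omega is contained in the half-space
    Re z + c > 0 as soon as c is large, which yields a solution on Omega for each
    such c.

    The metric is nowhere flat by a single curvature component. Since
    g_{w wbar} = 1 / (2 x) depends on x alone, only the quadratic term with
    k = l = z survives in R_{w wbar w wbar}, and it equals
    g_{w wbar} |d_w g_{w zbar}|^2 = 1 / (32 x^5), which never vanishes
    (curvature_sol).

    Plurisubharmonicity comes from convexity: pot lies above its tangent planes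
    (pot_tangent), and restricted to a circle in a complex line a tangent plane
    becomes a constant plus a combination of cos and sin, whose integral is
    2 pi times the value at the centre (plurisubharmonic_sol).

    Analyticity comes from separation of variables: pot is a sum of two products
    of functions of one variable, each of them a polynomial or an inverse, and a
    product of one-variable power series is an absolutely convergent multiple
    power series (real_analytic_separable).

    The solutions are pairwise distinct on Omega because pot (x, t) is strictly
    increasing in x where x >= 1 and x >= |t| (pot_lt); choosing c larger than
    twice a bound of Omega puts all of Omega in that range. *)

Set Implicit Arguments.
Unset Strict Implicit.
Unset Printing Implicit Defensive.

Local Notation Re := complex.Re.
Local Notation Im := complex.Im.

(** * Two-by-two matrices *)

(** In 'I_2 the index other than i is 1 - i. *)
Lemma cofactor2 (K : comNzRingType) (A : 'M[K]_2) (i j : 'I_2) :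
  cofactor A i j = (-1) ^+ (i + j) * A (1 - i) (1 - j).
Proof.
rewrite /cofactor det_mx11 !mxE; congr (_ * A _ _).
  by case: i => [[|[|]]] //= hi; apply: val_inj.
by case: j => [[|[|]]] //= hj; apply: val_inj.
Qed.

Lemma det2 (K : comNzRingType) (A : 'M[K]_2) :
  \det A = A 0 0 * A 1 1 - A 0 1 * A 1 0.
Proof.
rewrite (expand_det_row A 0) !big_ord_recl big_ord0 addr0.
rewrite (_ : lift 0 0 = 1); last exact/val_inj.
by rewrite !cofactor2 !subr0 subrr expr0 expr1 mul1r mulN1r mulrN.
Qed.

(** * Wirtinger derivatives of functions of the real parts *)

Section WirtingerDerivatives.
Variable R : realType.

Definition tube_fun (c : R) (F : R -> R -> R) (q : C2 R) : R[i] :=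
  (F (Re (q 0 0) + c) (Re (q 0 1)))%:C.

(** The factor 2 makes G the Wirtinger derivative: on functions of the real parts,
    both d/dz_j and d/dzbar_j act as half of the derivative along Re z_j. *)
Definition half_partial (j : 'I_2) (F G : R -> R -> R) : Prop :=
  forall x t : R, 0 < x ->
    if j == 0 then is_derive x 1 (fun s => F s t) (2 * G x t)
    else is_derive t 1 (F x) (2 * G x t).

Lemma Re_scale (s : R) (x : R[i]) : Re (s%:C * x) = s * Re x.
Proof. by case: x => a b /=; rewrite mul0r subr0. Qed.

(** The formula for f is only assumed where Re z + c > 0; that set is open, so the
    derivative at p does not see the values of f elsewhere. This lets derivatives
    be iterated for potentials that are singular on the boundary. *)
Lemma real_derive_tube_fun (c : R) (F : R -> R -> R) (f : C2 R -> R[i]) (v p : C2 R) (d : R) :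
  (forall q : C2 R, 0 < Re (q 0 0) + c -> f q = tube_fun c F q) ->
  0 < Re (p 0 0) + c ->
  is_derive (0 : R) 1
    (fun s => F (Re (p 0 0) + c + s * Re (v 0 0)) (Re (p 0 1) + s * Re (v 0 1))) d ->
  real_derive v f p = d%:C.
Proof.
move=> fE p0 dF; rewrite /real_derive !derive1E.
(* The point stays in the open half-space for small s. *)
have near0 : \forall s \near (0 : R), 0 < Re (p 0 0) + c + s * Re (v 0 0).
  have cont : {for (0 : R), continuous (fun s : R => Re (p 0 0) + c + s * Re (v 0 0))}.
    apply: cvgD; first exact: cvg_cst.
    by apply: cvgM; [exact: cvg_id | exact: cvg_cst].
  apply: (cont [set y | 0 < y]); rewrite /= mul0r addr0.
  exact: lt_nbhsr.
have E (s : R) : 0 < Re (p 0 0) + c + s * Re (v 0 0) ->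
   f (p + s%:C *: v) = (F (Re (p 0 0) + c + s * Re (v 0 0)) (Re (p 0 1) + s * Re (v 0 1)))%:C.
  move=> s0.
  have Ev j : Re ((p + s%:C *: v) 0 j) = Re (p 0 j) + s * Re (v 0 j).
    by rewrite !mxE raddfD /= Re_scale.
  by rewrite fE /tube_fun ?Ev // addrAC.
have -> : 'D_1 (fun t : R => Re (f (p + t%:C *: v))) 0 = d.
  rewrite -[RHS]derive_val; apply: near_eq_derive.
  by near=> s; rewrite E //; near: s.
have -> : 'D_1 (fun t : R => Im (f (p + t%:C *: v))) 0 = 0.
  rewrite -[RHS](@derive_val _ _ _ _ _ _ _ (is_derive_cst (0 : R) (0 : R) (1 : R))).
  by apply: near_eq_derive; near=> s; rewrite E //; near: s.
by [].
Unshelve. all: by end_near.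
Qed.

(** The derivative along i e_j vanishes, since that direction leaves the real parts
    unchanged; hence d/dz_j and d/dzbar_j agree. *)
Lemma wirtinger_tube_fun (c : R) F G (f : C2 R -> R[i]) (j : 'I_2) (p : C2 R) :
  half_partial j F G ->
  (forall q : C2 R, 0 < Re (q 0 0) + c -> f q = tube_fun c F q) ->
  0 < Re (p 0 0) + c ->
  dz j f p = tube_fun c G p /\ dzbar j f p = tube_fun c G p.
Proof.
move=> dF fE p0; rewrite /dz /dzbar.
have -> : real_derive ('i%C *: delta_mx 0 j) f p = 0%:C.
  apply: (@real_derive_tube_fun c F f _ p 0 fE p0 _).
  have Z k : Re (('i%C *: delta_mx 0 j : C2 R) 0 k) = 0.
    by rewrite !mxE; case: (_ && _) => /=; rewrite ?mul0r ?mul1r ?mulr0 ?subr0.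
  rewrite (_ : (fun _ => _) = cst (F (Re (p 0 0) + c) (Re (p 0 1)))).
    exact: is_derive_cst.
  by apply/funext => s /=; rewrite !Z !mulr0 !addr0.
have -> : real_derive (delta_mx 0 j) f p = (2 * G (Re (p 0 0) + c) (Re (p 0 1)))%:C.
  apply: (@real_derive_tube_fun c F f _ p (2 * G _ _) fE p0 _).
  have sh (y : R) : is_derive (0 : R) 1 (fun s : R => y + s) 1.
    rewrite -[X in is_derive _ _ _ X]add0r.
    exact: (is_deriveD (is_derive_cst y _ _) (is_derive_id _ _)).
  have := dF _ (Re (p 0 1)) p0.
  case: (unliftP 0 j) => [k|] -> /= d; last first.
    rewrite (_ : (fun _ => _) = (fun s => F s (Re (p 0 1))) \o
                                (fun s => Re (p 0 0) + c + s)); last first.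
      by apply/funext => s /=; rewrite !mxE /= mulr1 mulr0 addr0.
    rewrite -[X in is_derive _ _ _ X]mulr1; apply: is_derive1_comp.
    by rewrite addr0.
  move: d; rewrite (ord1 k) (_ : lift 0 0 = 1) => [d|]; last exact/val_inj.
  rewrite (_ : (fun _ => _) = (F (Re (p 0 0) + c)) \o (fun s => Re (p 0 1) + s)); last first.
    by apply/funext => s /=; rewrite !mxE /= mulr1 mulr0 addr0.
  rewrite -[X in is_derive _ _ _ X]mulr1; apply: is_derive1_comp.
  by rewrite addr0.
have -> : (0 : R)%:C = 0 by [].
rewrite mulr0 subr0 addr0 /tube_fun rmorphM /= rmorph_nat mulrAC.
by rewrite divff ?mul1r ?pnatr_eq0.
Qed.

End WirtingerDerivatives.

(** * The potential, its metric and its curvature *)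

Section Metric.
Variable R : realType.

Lemma is_derive_laurent (a : R) n (b : R) m (f : R -> R) (x d : R) : 0 < x ->
  (forall s, f s = a * s ^+ n + b * s^-1 ^+ m) ->
  d = a * n%:R * x ^+ n.-1 - b * m%:R * x^-1 ^+ m.+1 ->
  is_derive x 1 f d.
Proof.
move=> x0 /funext -> ->.
have dV : is_derive x 1 (fun s : R => s^-1) (- x ^- 2).
  have := @is_deriveV R id x 1 1 (lt0r_neq0 x0) (is_derive_id _ _).
  by rewrite /= scaler1.
have dX := is_deriveX n (is_derive_id x (1 : R)).
have dY := is_deriveX m dV.
have := is_deriveD (is_deriveZ a dX) (is_deriveZ b dY).
rewrite (_ : a *: _ + _ = fun s : R => a * s ^+ n + b * s^-1 ^+ m); last first.
  by apply/funext => s; rewrite !fctE.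
move/is_derive_eq; apply.
rewrite /GRing.scale /=.
have -> : b * m%:R * x^-1 ^+ m.+1 = b * (m%:R * x^-1 ^+ m.-1 * x ^- 2).
  case: m {dY} => [|m] /=; first by rewrite mulr0 !mul0r mulr0.
  by rewrite -exprVn -!mulrA -exprD addn2.
ring.
Qed.

Lemma is_derive_quadratic (a b d : R) (f : R -> R) (x e : R) :
  (forall s, f s = a + b * s + d * s ^+ 2) -> e = b + 2 * d * x ->
  is_derive x 1 f e.
Proof.
move=> /funext -> ->.
have := is_deriveD (is_deriveD (is_derive_cst a x (1 : R)) (is_deriveZ b (is_derive_id x (1 : R))))
  (is_deriveZ d (is_deriveX 2 (is_derive_id x (1 : R)))).
rewrite (_ : _ + _ = fun s : R => a + b * s + d * s ^+ 2); last first.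
  by apply/funext => s; rewrite !fctE.
by move/is_derive_eq; apply; rewrite /GRing.scale /=; ring.
Qed.

Definition pot (x t : R) : R := 4 / 3 * x ^+ 3 + t ^+ 2 * x^-1.

Definition sol (c : R) (q : C2 R) : R := pot (Re (q 0 0) + c) (Re (q 0 1)).

(** The Wirtinger derivatives of pot, that is, half of its real gradient; hess below
    is likewise a quarter of the real Hessian of pot. *)
Definition grad (j : 'I_2) (x t : R) : R :=
  if j == 0 then 2 * x ^+ 2 - t ^+ 2 * x^-1 ^+ 2 / 2 else t * x^-1.

Definition hess (j k : 'I_2) (x t : R) : R :=
  if j == 0 then
    if k == 0 then 2 * x + t ^+ 2 * x^-1 ^+ 3 / 2 else - t * x^-1 ^+ 2 / 2
  else if k == 0 then - t * x^-1 ^+ 2 / 2 else x^-1 / 2.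

Lemma grad_pot j : half_partial j pot (grad j).
Proof.
move=> x t x0; rewrite /grad /pot; case: (j == 0).
  by apply: (@is_derive_laurent (4 / 3) 3 (t ^+ 2) 1) => //= *;
      first [ring | field; exact: lt0r_neq0].
by apply: (@is_derive_quadratic (4 / 3 * x ^+ 3) 0 x^-1) => //= *;
      first [ring | field; exact: lt0r_neq0].
Qed.

Lemma hess_grad j k : half_partial j (grad k) (hess j k).
Proof.
move=> x t x0; rewrite /grad /hess.
case: (j == 0); case: (k == 0).
- by apply: (@is_derive_laurent 2 2 (- (t ^+ 2 / 2)) 2) => //= *;
      first [ring | field; exact: lt0r_neq0].
- by apply: (@is_derive_laurent 0 0 t 1) => //= *;
      first [ring | field; exact: lt0r_neq0].
- by apply: (@is_derive_quadratic (2 * x ^+ 2) 0 (- (x^-1 ^+ 2 / 2))) => //= *;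
      first [ring | field; exact: lt0r_neq0].
- by apply: (@is_derive_quadratic 0 x^-1 0) => //= *;
      first [ring | field; exact: lt0r_neq0].
Qed.

(** Up to the symmetry of the metric, this is the only nonzero first derivative that
    enters R_{w wbar w wbar}, so it is what makes the metric curved. *)
Lemma dw_hess_01 : half_partial 1 (hess 0 1) (fun x t => - x^-1 ^+ 2 / 4).
Proof.
move=> x t x0 /=; rewrite /hess /=.
by apply: (@is_derive_quadratic 0 (- (x^-1 ^+ 2 / 2)) 0) => //= *;
  first [ring | field; exact: lt0r_neq0].
Qed.

Lemma dw_hess_11 : half_partial 1 (hess 1 1) (fun x t => 0).
Proof. by move=> x t x0 /=; rewrite /hess /= mulr0; exact: is_derive_cst. Qed.

Lemma half_partial0 j : half_partial j (fun _ _ => 0 : R) (fun _ _ => 0).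
Proof. by move=> x t x0; case: ifP => _; rewrite mulr0; exact: is_derive_cst. Qed.

Lemma complex_hessian_sol (c : R) (q : C2 R) j k : 0 < Re (q 0 0) + c ->
  complex_hessian (sol c) q j k = tube_fun c (hess j k) q.
Proof.
move=> q0; rewrite mxE.
have g (p : C2 R) : 0 < Re (p 0 0) + c ->
    dzbar k (fun q => (sol c q)%:C) p = tube_fun c (grad k) p.
  by move=> p0; case: (wirtinger_tube_fun (@grad_pot k) (fun r _ => erefl (tube_fun c pot r)) p0).
by case: (wirtinger_tube_fun (@hess_grad j k) g q0).
Qed.

Lemma det_complex_hessian_sol (c : R) (q : C2 R) : 0 < Re (q 0 0) + c ->
  \det (complex_hessian (sol c) q) = 1.
Proof.
move=> q0.
have E : complex_hessian (sol c) q =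
    map_mx (real_complex R) (\matrix_(j, k) hess j k (Re (q 0 0) + c) (Re (q 0 1))).
  by apply/matrixP => j k; rewrite complex_hessian_sol // !mxE.
rewrite E det_map_mx (_ : \det _ = 1) ?rmorph1 // det2 !mxE /hess /=.
by field; exact: lt0r_neq0.
Qed.

(** The second derivative of g_{w wbar} = 1 / (2 x) along w vanishes, and in the
    quadratic term only k = l = z contributes. As the determinant is 1, the entry
    of the inverse matrix in that term is g_{w wbar} itself, so the component is
    (1 / (2 x)) (1 / (4 x^2))^2. *)
Lemma curvature_sol (c : R) (q : C2 R) : 0 < Re (q 0 0) + c ->
  curvature (sol c) q 1 1 1 1 = ((Re (q 0 0) + c)^-1 ^+ 5 / 32)%:C.
Proof.
move=> q0; rewrite /curvature.
have H j k (p : C2 R) (p0 : 0 < Re (p 0 0) + c) := @complex_hessian_sol c p j k p0.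
have T0 : tube_fun c (fun _ _ => 0) q = 0 by [].
have D11 p p0 := @wirtinger_tube_fun R c _ _ _ 1 p dw_hess_11 (H 1 1) p0.
have D2 : dz 1 (dzbar 1 (fun q => complex_hessian (sol c) q 1 1)) q = 0.
  by rewrite (proj1 (wirtinger_tube_fun (@half_partial0 1) (fun p p0 => proj2 (D11 p p0)) q0)).
have D01 := wirtinger_tube_fun dw_hess_01 (H 0 1) q0.
(* hess 1 0 and hess 0 1 are the same function. *)
have D10 := wirtinger_tube_fun dw_hess_01 (H 1 0) q0.
have U : complex_hessian (sol c) q \in unitmx.
  by rewrite unitmxE det_complex_hessian_sol // unitr1.
rewrite !big_ord_recl !big_ord0 (_ : lift 0 0 = 1); last exact/val_inj.
rewrite D2 (proj1 (D11 q q0)) (proj2 (D11 q q0)) (proj1 D10) (proj2 D01).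
rewrite T0 !(mulr0, mul0r, addr0, oppr0, add0r).
rewrite /invmx U det_complex_hessian_sol // invr1 scale1r.
rewrite (_ : \adj _ 0 0 = complex_hessian (sol c) q 1 1); last first.
  by rewrite mxE cofactor2 subr0 expr0 mul1r.
rewrite H // /tube_fun -!rmorphM /hess /=.
by congr (_%:C); field; exact: lt0r_neq0.
Qed.

Lemma nowhere_flat_sol (c : R) (D : set (C2 R)) :
  (forall q, D q -> 0 < Re (q 0 0) + c) -> nowhere_flat D (sol c).
Proof.
move=> D0 q /D0 q0; exists 1, 1, 1, 1; rewrite curvature_sol //.
by rewrite fmorph_eq0 mulf_neq0 ?invr_neq0 ?expf_neq0 ?invr_neq0 ?lt0r_neq0 ?pnatr_eq0.
Qed.

End Metric.

(** * Convexity and plurisubharmonicity *)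

Section Plurisubharmonicity.
Variable R : realType.

Lemma continuous_Re : continuous (fun z : R[i]^o => Re z : R).
Proof.
move=> z A /nbhs_ballP[e e0 eA]; apply/nbhs_ballP; exists e%:C => [|w zw].
  by rewrite /= ltcR.
apply: eA; rewrite -ball_normE /= -ltcR -raddfB.
exact: le_lt_trans (normc_ge_Re _) zw.
Qed.

(** The difference of the two sides is
    4/3 (x - x0)^2 (x + 2 x0) + x (t/x - t0/x0)^2, hence nonnegative. *)
Lemma pot_tangent (x t x0 t0 : R) : 0 < x -> 0 < x0 ->
  pot x0 t0 + (4 * x0 ^+ 2 - t0 ^+ 2 / x0 ^+ 2) * (x - x0) + 2 * t0 / x0 * (t - t0) <= pot x t.
Proof.
move=> xp x0p; rewrite -subr_ge0 /pot.
rewrite [leRHS](_ : _ = 4 / 3 * ((x - x0) ^+ 2 * (x + 2 * x0)) + x * (t / x - t0 / x0) ^+ 2).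
  apply: addr_ge0; last by rewrite mulr_ge0 ?sqr_ge0 // ltW.
  by apply: mulr_ge0; [lra | rewrite mulr_ge0 ?sqr_ge0 //; lra].
by field; rewrite !lt0r_neq0.
Qed.

Lemma pot_continuous (T : topologicalType) (f g : T -> R) (p : T) :
  0 < f p -> {for p, continuous f} -> {for p, continuous g} ->
  {for p, continuous (fun q => pot (f q) (g q))}.
Proof.
move=> fp cf cg; apply: cvgD.
  apply: cvgM; first exact: cvg_cst.
  by apply: cvgM => //; apply: cvgM.
apply: cvgM; first exact: cvgM.
by apply: cvgV => //; exact: lt0r_neq0.
Qed.

Lemma continuous_usc (T : topologicalType) (D : set T) (f : T -> R) :
  (forall p, D p -> {for p, continuous f}) -> usc_on D f.
Proof.
by move=> cf p Dp c fc; apply: (cf p Dp [set y | y < c]); exact: lt_nbhsl.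
Qed.

Lemma continuous_shift (T : topologicalType) (f : T -> R) (c : R) (p : T) :
  {for p, continuous f} -> {for p, continuous (fun q => f q + c)}.
Proof. by move=> cf; apply: cvgD => //; exact: cvg_cst. Qed.

Lemma continuous_line (K : numFieldType) (V : normedModType K) (a b : V) :
  continuous (fun x : K => a + x *: b).
Proof.
by move=> x; exact: (cvgD (cvg_cst a) (@scalel_continuous _ _ b x)).
Qed.

Lemma sol_continuous (c : R) (q : C2 R) : 0 < Re (q 0 0) + c ->
  {for q, continuous (sol c)}.
Proof.
have cR j : continuous (fun q : C2 R => Re (q 0 j)).
  move=> p; apply: (@continuous_comp _ _ _ (fun q : C2 R => q 0 j : R[i]^o)).
    exact: coord_continuous.
  exact: continuous_Re.
move=> q0; apply: pot_continuous => //.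
  by apply: continuous_shift; exact: cR.
exact: cR.
Qed.

Lemma integral_trig (k a b : R) :
  (\int[lebesgue_measure]_(t in `[0%R, (2 * pi)%R]) (k + a * cos t + b * sin t)%:E
   = (2 * pi * k)%:E)%E.
Proof.
(* A primitive; its trigonometric part has period 2 pi. *)
pose F (t : R) := k * t + a * sin t - b * cos t.
have dF (t : R) : is_derive t 1 F (k + a * cos t + b * sin t).
  have := is_deriveB
    (is_deriveD (is_deriveZ k (is_derive_id t (1 : R))) (is_deriveZ a (is_derive_sin t)))
    (is_deriveZ b (is_derive_cos t)).
  rewrite (_ : _ - _ = F); last by apply/funext => s; rewrite !fctE.
  by move/is_derive_eq; apply; rewrite /GRing.scale /=; ring.
have cF : continuous F.
  by move=> t; apply: differentiable_continuous; apply/derivable1_diffP; case: (dF t).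
rewrite (@continuous_FTC2 _ _ F).
- rewrite -EFinB /F sin0 cos0 (_ : 2 * pi = pi + pi :> R); last by ring.
  by rewrite sinDpi cosDpi sinpi cospi; congr (_%:E); ring.
- by rewrite mulr_gt0 ?pi_gt0.
- apply: continuous_subspaceT => t; apply: cvgD; first apply: cvgD.
  + exact: cvg_cst.
  + by apply: cvgM; [exact: cvg_cst | exact: continuous_cos].
  + by apply: cvgM; [exact: cvg_cst | exact: continuous_sin].
- split.
  + by move=> t _; case: (dF t).
  + exact/cvg_at_right_filter/cF.
  + exact/cvg_at_left_filter/cF.
- by move=> t _; rewrite derive1E; case: (dF t).
Qed.

Lemma plurisubharmonic_sol (c : R) (D : set (C2 R)) :
  (forall q, D q -> 0 < Re (q 0 0) + c) -> plurisubharmonic D (sol c).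
Proof.
move=> D0; split; first by apply: continuous_usc => q /D0; exact: sol_continuous.
move=> a b; split.
  apply: continuous_usc => z /= /D0 Dz.
  apply: (@continuous_comp _ _ _ (fun x : R[i]^o => a + x *: b) (sol c)); last first.
    exact: sol_continuous.
  exact: (@continuous_line _ (C2 R)).
move=> z r r0 disc.
pose circ (t : R) : C2 R := a + (z + r%:C * (cos t +i* sin t)) *: b.
have DC t : 0 < Re (circ t 0 0) + c.
  apply/D0/disc; rewrite addrC addKr normrM.
  rewrite !normc_def /= cos2Dsin2 sqrtr1 expr0n /= addr0 sqrtr_sqr gtr0_norm //.
  by rewrite mulr1.
have D00 : 0 < Re ((a + z *: b) 0 0) + c.
  by apply/D0/disc; rewrite subrr normr0 lecR ltW.
have circE t j : Re (circ t 0 j) =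
    Re ((a + z *: b) 0 j) + r * Re (b 0 j) * cos t - r * Im (b 0 j) * sin t.
  rewrite !mxE; case: (a 0 j) (b 0 j) (z) => [? ?] [? ?] [? ?] /=; ring.
have ccirc j : continuous (fun t => Re (circ t 0 j)).
  move=> t; under eq_fun do rewrite circE.
  apply: cvgB; first apply: cvgD.
  - exact: cvg_cst.
  - by apply: cvgM; [exact: cvg_cst | exact: continuous_cos].
  - by apply: cvgM; [exact: cvg_cst | exact: continuous_sin].
set x0 := Re ((a + z *: b) 0 0) + c in D00.
set t0 := Re ((a + z *: b) 0 1).
(* A and B are the partial derivatives of pot at the centre of the disc; ca and sa
   are the coefficients of cos and sin of the tangent plane along the circle. *)
pose A := 4 * x0 ^+ 2 - t0 ^+ 2 / x0 ^+ 2.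
pose B := 2 * t0 / x0.
pose ca := A * (r * Re (b 0 0)) + B * (r * Re (b 0 1)).
pose sa := - (A * (r * Im (b 0 0)) + B * (r * Im (b 0 1))).
rewrite -[X in (X <= _)%E](integral_trig _ ca sa).
apply: le_integral => //=.
- apply: (@continuous_compact_integrable R
    (fun t => pot x0 t0 + ca * cos t + sa * sin t)); first exact: segment_compact.
  apply: continuous_subspaceT => t; apply: cvgD; first apply: cvgD.
  + exact: cvg_cst.
  + by apply: cvgM; [exact: cvg_cst | exact: continuous_cos].
  + by apply: cvgM; [exact: cvg_cst | exact: continuous_sin].
- apply: (@continuous_compact_integrable R (fun t => sol c (circ t))); first
    exact: segment_compact.
  apply: continuous_subspaceT => t.
  exact: (@pot_continuous R _ _ t (DC t) (continuous_shift (ccirc 0 t)) (ccirc 1 t)).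
- move=> t _; rewrite lee_fin.
  have := @pot_tangent _ (Re (circ t 0 1)) x0 t0 (DC t) D00.
  apply: le_trans; rewrite !circE -/x0 -/t0 le_eqVlt; apply/orP; left; apply/eqP.
  rewrite /sol -/x0 -/t0 -/A -/B /ca /sa /x0; ring.
Qed.

End Plurisubharmonicity.

(** * Real analyticity *)

Section Analyticity.
Variable R : realType.

Definition sums_to (f : R -> R) (a : nat -> R) (r : R) : Prop :=
  forall h, `|h| < r ->
    cvgn (series (fun k => `|a k * h ^+ k|)) /\
    series (fun k => a k * h ^+ k) @ \oo --> f h.

Lemma sums_to_poly (p : {poly R}) r : sums_to (fun h => p.[h]) (fun k => p`_k) r.
Proof.
move=> h _.
have E : \forall N \near \oo, (size p <= N)%N by exact: nbhs_infty_ge.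
split.
  apply/cvg_ex; exists (\sum_(0 <= k < size p) `|p`_k * h ^+ k|).
  apply: cvg_near_cst; near=> N.
  rewrite /series /= (big_cat_nat (n := size p)) //=; last by near: N.
  rewrite [X in _ + X]big_nat_cond [X in _ + X]big1 ?addr0 // => k.
  by rewrite andbT => /andP[pk _]; rewrite nth_default // mul0r normr0.
apply: cvg_near_cst; near=> N.
rewrite /series /= big_mkord (horner_coef_wide _ (n := N)) //.
by near: N.
Unshelve. all: by end_near.
Qed.

(** The geometric series of ratio - h / x. *)
Lemma sums_to_inv (x : R) : 0 < x ->
  sums_to (fun h => (x + h)^-1) (fun k => x^-1 * (- x^-1) ^+ k) x.
Proof.
move=> x0 h hx.
have q1 : `|- x^-1 * h| < 1.
  by rewrite mulNr normrN mulrC normrM normfV (gtr0_norm x0) ltr_pdivrMr // mul1r.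
have E : (fun k => x^-1 * (- x^-1) ^+ k * h ^+ k) = geometric x^-1 (- x^-1 * h).
  by apply/funext => k; rewrite /= -mulrA -exprMn.
split.
  rewrite (_ : (fun k => _) = geometric `|x^-1| `|- x^-1 * h|).
    by apply: is_cvg_geometric_series; rewrite normr_id.
  by apply/funext => k; rewrite /= -mulrA -exprMn normrM normrX.
rewrite E (_ : (x + h)^-1 = x^-1 / (1 - (- x^-1 * h))); first exact: cvg_geometric_series.
have : 0 < x + h by move: hx; rewrite ltr_norml => /andP[]; lra.
move=> /lt0r_neq0 xh; field; rewrite lt0r_neq0 //=.
by rewrite mulN1r opprK.
Qed.

Definition pad n N (m : {ffun 'I_n -> 'I_N}) : {ffun 'I_n -> nat} := [ffun i => m i : nat].

Lemma pad_inj n N : injective (@pad n N).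
Proof.
move=> m m' /ffunP e; apply/ffunP => i; apply/val_inj.
by move: (e i); rewrite !ffunE.
Qed.

Lemma finite_sub_pad n (X : set {ffun 'I_n -> nat}) : finite_set X ->
  exists N, X `<=` range (@pad n N).
Proof.
move=> Xfin; pose M := \max_(m <- fset_set X) \max_(i < n) m i.
exists M.+1 => m Xm.
have mM i : (m i < M.+1)%N.
  rewrite ltnS (leq_trans (leq_bigmax i)) //.
  apply: (leq_bigmax_seq (F := fun m : {ffun _ -> nat} => \max_i m i)) => //.
  by rewrite in_fset_set //; exact: mem_set.
exists [ffun i => Ordinal (mM i)] => //.
by apply/ffunP => i; rewrite !ffunE.
Qed.

(** Any finite set of multi-indices lies in some cube, so a uniform bound on the
    sums over cubes bounds all finite sums. *)
Lemma summable_box n (t : {ffun 'I_n -> nat} -> R) (C : R) :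
  (forall N, \sum_(m : {ffun 'I_n -> 'I_N}) `|t (pad m)| <= C) ->
  summable [set: {ffun 'I_n -> nat}] (fun m => (t m)%:E).
Proof.
move=> tC; rewrite /summable; apply: (@le_lt_trans _ _ C%:E); last exact: ltry.
apply: ge_ereal_sup => _ [X [Xfin _] <-].
have [N XN] := finite_sub_pad Xfin.
pose cube := map (@pad n N) (enum {ffun 'I_n -> 'I_N}).
have u : uniq cube.
  by rewrite map_inj_uniq ?enum_uniq //; exact: pad_inj.
apply: (@le_trans _ _ (\sum_(m \in [set` cube]) `|(t m)%:E|)%E).
  apply: lee_fsum_nneg_subset => //; first exact: finite_seq.
  move=> m /set_mem/XN[k _ <-]; apply: mem_set.
  by rewrite /= map_f // mem_enum.
rewrite -fsbig_seq // big_map big_enum /=.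
rewrite sumEFin lee_fin; exact: tC.
Qed.

(** By distributivity the sum over a cube of the products of the one-variable terms
    is the product of one-variable partial sums. This gives the convergence, and,
    applied to absolute values, the bound needed for summability. *)
Lemma real_analytic_separable n (F : 'rV[R]_n -> R) (x : 'rV[R]_n)
    (f : 'I_n -> R -> R) (a : 'I_n -> nat -> R) (r : R) : 0 < r ->
  (forall i, sums_to (f i) (a i) r) ->
  (forall h : 'rV[R]_n, (forall i, `|h 0 i| < r) -> F (x + h) = \prod_i f i (h 0 i)) ->
  real_analytic_at F x.
Proof.
move=> r0 fa FE; exists (fun m => \prod_i a i (m i)), r; split=> // h hr.
(* The general term is itself a product over the coordinates. *)
have tE (m : {ffun 'I_n -> nat}) :
    (\prod_i a i (m i)) * monomial m h = \prod_i (a i (m i) * h 0 i ^+ m i).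
  by rewrite big_split.
split.
  pose C i := limn (series (fun k => `|a i k * h 0 i ^+ k|)).
  apply: (@summable_box _ _ (\prod_i C i)) => N.
  rewrite (_ : \sum_m _ = \prod_i \sum_(k < N) `|a i k * h 0 i ^+ k|); last first.
    rewrite bigA_distr_bigA; apply: eq_bigr => m _; rewrite /= tE normr_prod.
    by apply: eq_bigr => i _; rewrite ffunE.
  apply: ler_prod => i _; apply/andP; split; first exact: sumr_ge0.
  have [cv _] := fa i _ (hr i).
  have := nondecreasing_cvgn_le _ cv N; rewrite /series /= big_mkord; apply.
  by apply: nondecreasing_series => k _ _.
rewrite FE //.
rewrite (_ : (fun N => _) =
  fun N => \prod_(i < n) series (fun k => a i k * h 0 i ^+ k) N); last first.
  apply/funext => N; under [RHS]eq_bigr do rewrite /series /= big_mkord.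
  rewrite bigA_distr_bigA; apply: eq_bigr => m _; rewrite tE.
  by apply: eq_bigr => i _; rewrite ffunE.
apply: (@cvg_big _ _ _ _ _ (@mul_continuous R)) => i _.
by have [] := fa i _ (hr i).
Qed.

Lemma real_analyticD n (F G : 'rV[R]_n -> R) (x : 'rV[R]_n) :
  real_analytic_at F x -> real_analytic_at G x ->
  real_analytic_at (fun y => F y + G y) x.
Proof.
move=> [a [r [r0 Fa]]] [b [s [s0 Gb]]].
exists (fun m => a m + b m), (Num.min r s); split; first by rewrite lt_min r0.
move=> h hrs.
have hr i : `|h 0 i| < r by apply: lt_le_trans (hrs i) _; rewrite ge_min lexx.
have hs i : `|h 0 i| < s by apply: lt_le_trans (hrs i) _; rewrite ge_min lexx orbT.
have [sF cF] := Fa h hr; have [sG cG] := Gb h hs.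
split.
  rewrite (_ : (fun m => _) = (fun m => (a m * monomial m h)%:E) \+
                              (fun m => (b m * monomial m h)%:E))%E.
    exact: summableD.
  by apply/funext => m; rewrite /= mulrDl.
pose psum (e : {ffun 'I_n -> nat} -> R) (N : nat) : R :=
  \sum_(m : {ffun 'I_n -> 'I_N}) e (pad m) * monomial (pad m) h.
rewrite (_ : (fun N => _) = psum a \+ psum b).
  exact: cvgD.
by apply/funext => N /=; rewrite -big_split; apply: eq_bigr => m _; rewrite mulrDl.
Qed.

Lemma real_analytic_sol (c : R) (D : set (C2 R)) :
  (forall q, D q -> 0 < Re (q 0 0) + c) -> real_analytic_on D (sol c).
Proof.
move=> D0 x /D0; rewrite mxE /=.
set X := x 0 (lshift 2 0) + c => X0.
pose T := x 0 (lshift 2 1).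
rewrite (_ : (fun y => _) = fun y : 'rV[R]_(2 + 2) =>
   4 / 3 * (y 0 (lshift 2 0) + c) ^+ 3 +
   y 0 (lshift 2 1) ^+ 2 * (y 0 (lshift 2 0) + c)^-1); last first.
  by apply/funext => y; rewrite /sol /pot !mxE.
apply: real_analyticD.
- pose p : {poly R} := (4 / 3) *: ('X + X%:P) ^+ 3.
  pose P (i : 'I_(2 + 2)) : {poly R} := if i == lshift 2 0 then p else 1.
  apply: (@real_analytic_separable _ _ _ (fun i h => (P i).[h]) (fun i k => (P i)`_k) 1) => //.
    by move=> i; exact: sums_to_poly.
  move=> h _; rewrite big_split_ord /= !big_ord_recl !big_ord0 /P !eq_lshift !eq_rlshift /=.
  rewrite !(hornerZ, horner_exp, hornerD, hornerX, hornerC) !mulr1 mxE.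
  by rewrite /X addrAC [h 0 _ + _]addrC.
- pose P (i : 'I_(2 + 2)) : {poly R} := if i == lshift 2 1 then ('X + T%:P) ^+ 2 else 1.
  pose f i h := if i == lshift 2 0 then (X + h)^-1 else (P i).[h].
  pose a i k := if i == lshift 2 0 then X^-1 * (- X^-1) ^+ k else (P i)`_k.
  apply: (@real_analytic_separable _ _ _ f a X) => //.
    by move=> i; rewrite /f /a; case: (i == _); [exact: sums_to_inv | exact: sums_to_poly].
  move=> h _; rewrite big_split_ord /= !big_ord_recl !big_ord0 /f /P !eq_lshift !eq_rlshift /=.
  rewrite !(horner_exp, hornerD, hornerX, hornerC) !mulr1 !mxE.
  rewrite mulrC (_ : lift 0 0 = 1) ?[h 0 _ + T]addrC; last exact/val_inj.
  by rewrite /X addrAC.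
Qed.

End Analyticity.

(** * Infinitely many solutions on a bounded domain *)

Lemma infinite_set_inj_seq (T : Type) (S : set T) (g : nat -> T) :
  injective g -> (forall n, S (g n)) -> infinite_set S.
Proof.
move=> gI gS Sfin; apply: infinite_nat.
rewrite (_ : [set: nat] = g @^-1` S); last by rewrite eqEsubset; split=> // n _; exact: gS.
by apply: finite_preimage Sfin => m n _ _; exact: gI.
Qed.

Section Distinct.
Variable R : realType.

Lemma bounded_set_Re (D : set (C2 R)) : bounded_set D ->
  exists2 B : R, 0 < B & forall p, D p -> forall j, `|Re (p 0 j)| < B.
Proof.
move=> /(pinfty_ex_gt (real0 _))[M M0 DM].
have M1 : M < M + 1 by rewrite ltrDl.
have ME : (Re (M + 1))%:C = M + 1.
  by apply/RRe_real/ger0_real/ltW/(lt_trans M0).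
exists (Re (M + 1)) => [|p Dp j]; first by rewrite -ltcR ME (lt_trans M0).
rewrite -ltcR ME; apply: le_lt_trans (normc_ge_Re _) _.
have : ball (0 : C2 R) (M + 1) p.
  by rewrite -ball_normE /ball_ /= sub0r normrN (le_lt_trans _ M1) // DM.
by move=> [_ /(_ 0 j)]; rewrite mxE -ball_normE /ball_ /= sub0r normrN.
Qed.

(** The tangent at (x, t) has slope 4 x^2 - t^2 / x^2 in the first variable, which
    is at least 4 - 1 in this range. *)
Lemma pot_lt (x y t : R) : 1 <= x -> `|t| <= x -> x < y -> pot x t < pot y t.
Proof.
move=> x1 tx xy; have x0 : 0 < x by lra.
have := @pot_tangent R y t x t (lt_trans x0 xy) x0; apply: lt_le_trans.
rewrite subrr mulr0 addr0 ltrDl mulr_gt0 ?subr_gt0 //.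
rewrite ltr_pdivrMr ?exprn_gt0 //.
have : t ^+ 2 <= x ^+ 2 by rewrite -real_normK ?num_real // ler_pXn2r ?nnegrE // ltW.
by have : 1 <= x ^+ 2; [rewrite exprn_ege1 | nra].
Qed.

End Distinct.

(* A function on Omega is the restriction sigL Omega u of a total function u;
   all the conditions on u depend only on this restriction, as Omega is open. *)
Theorem corollary3p2 (R : realType) (Omega : set (C2 R)) :
  is_domain Omega -> bounded_set Omega ->
  infinite_set (sigL Omega @`
    [set u : C2 R -> R |
      [/\ real_analytic_on Omega u,
          plurisubharmonic Omega u,
          forall p, Omega p -> \det (complex_hessian u p) = 1 &
          nowhere_flat Omega u]]).
Proof.
move=> [[p0 Op0] _ _] /bounded_set_Re[B B0 OB].
(* 2 B keeps Re z + c above B + 1, hence above both 1 and |Re w|. *)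
pose c n : R := 2 * B + 1 + n%:R.
have cB n p : Omega p -> B + 1 + n%:R <= Re (p 0 0) + c n.
  by move=> /OB/(_ 0); rewrite ltr_norml /c => /andP[]; lra.
have c0 n p : Omega p -> 0 < Re (p 0 0) + c n.
  by move=> /(cB n); have := ler0n R n; lra.
apply: (@infinite_set_inj_seq _ _ (fun n => sigL Omega (sol (c n)))) => [m n|n].
  move=> /eq_sigLP /(_ p0 (mem_set Op0)) smn.
  have lt i j : (i < j)%N -> sol (c i) p0 < sol (c j) p0.
    move=> ij; have := ler0n R i; have := cB i p0 Op0; have := OB p0 Op0 1.
    move=> ? ? ?; apply: pot_lt; [lra | lra | rewrite ltrD2l /c ltrD2l ltr_nat //].
  by case: (ltngtP m n) => // /lt; rewrite smn ltxx.
exists (sol (c n)) => //; split.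
- exact: real_analytic_sol (c0 n).
- exact: plurisubharmonic_sol (c0 n).
- by move=> p /(c0 n); exact: det_complex_hessian_sol.
- exact: nowhere_flat_sol (c0 n).
Qed.
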